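(* For every countable ordinal $\alpha$, the space $C_p([1,\alpha])$ is hereditarily distinguished, i.e. every closed linear subspace of $C_p([1,\alpha])$ (with the induced topology) is distinguished.
   Context: For an ordinal $\alpha$, $[1,\alpha]$ denotes the compact space of all ordinals $\gamma$ with $1\le\gamma\le\alpha$, with the order topology. For a Tychonoff space $X$, $C_p(X)$ is the vector space of all continuous functions $X\to\mathbb{R}$ with the topology of pointwise convergence. For a locally convex space $E$, the strong dual $E'_\beta$ is the topological dual $E'$ with the strong topology $\beta(E',E)$ of uniform convergence on bounded subsets of $E$. $E$ is called distinguished if $E'_\beta$ is barrelled (every closed absolutely convex absorbing set is a neighbourhood of zero). *)

(* Defs.v *)
From HB Require Import structures.
From mathcomp Require Import all_boot all_order all_algebra.
From mathcomp Require Import all_classical all_reals all_analysis.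
Import Order.TTheory GRing.Theory Num.Theory.
Import numFieldNormedType.Exports.

Set Implicit Arguments.
Unset Strict Implicit.
Unset Printing Implicit Defensive.

Local Open Scope classical_set_scope.
Local Open Scope ring_scope.

(* Ordinals are represented as the elements of an arbitrary well-ordered type
   O with least element \bot = 0: every ordinal a is, up to isomorphism, an
   element of such an O (for instance of a + 1), and then identifies with the
   set of the elements of O below it. *)
Definition countable_ordinal d (O : bOrderType d) (a : O) : Prop :=
  countable [set b : O | (b < a)%O].

(* [1, a]: since 1 is the successor of 0, 1 <= c means 0 < c. *)
Definition ord_itv1 d (O : bOrderType d) (a : O) : Type :=
  {c : O | (\bot < c <= a)%O}.

HB.instance Definition _ d (O : bOrderType d) (a : O) :=
  SubType.copy (ord_itv1 a) {c : O | (\bot < c <= a)%O}.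
HB.instance Definition _ d (O : bOrderType d) (a : O) :=
  [Choice of ord_itv1 a by <:].
HB.instance Definition _ d (O : bOrderType d) (a : O) :=
  [SubChoice_isSubOrder of ord_itv1 a by <: with d].

(* A linear subspace of a topological vector space, with the induced
   operations and the induced topology. *)
Definition linear_subspace (R : realType) (E : preTopologicalLmodType R)
    (M : submodClosed E) : Type := {x : E | x \in M}.

Section linear_subspace_instances.
Context (R : realType) (E : preTopologicalLmodType R) (M : submodClosed E).

HB.instance Definition _ :=
  SubType.copy (linear_subspace M) {x : E | x \in M}.
HB.instance Definition _ := [Choice of linear_subspace M by <:].
HB.instance Definition _ := [SubChoice_isSubLmodule of linear_subspace M by <:].
HB.instance Definition _ := Topological.copy (linear_subspace M)
  (initial_topology (\val : linear_subspace M -> E)).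

End linear_subspace_instances.

(* The vector space operations on {ptws X -> R} and {family F, E -> R} are the
   pointwise ones. *)
HB.instance Definition _ (R : realType) (X : Type) :=
  GRing.Lmodule.copy {ptws X -> R^o} (X -> R^o).
HB.instance Definition _ (R : realType) (E : choiceType) (F : set E -> Prop) :=
  GRing.Lmodule.copy {family F, E -> R^o} (E -> R^o).

Section Cp.
Context (R : realType) (X : topologicalType).

Definition continuous_funs : {pred {ptws X -> R^o}} :=
  fun f => `[< continuous (f : X -> R^o) >].

Lemma continuous_funs_closed : GRing.submod_closed continuous_funs.
Proof.
split; first by apply/asboolP => x; exact: cvg_cst.
move=> k f g /asboolP cf /asboolP cg; apply/asboolP => x.
by apply: cvgD; [apply: cvgZl_tmp; exact: cf|exact: cg].
Qed.

HB.instance Definition _ :=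
  GRing.isSubmodClosed.Build R {ptws X -> R^o} continuous_funs
    continuous_funs_closed.

Definition Cp := linear_subspace continuous_funs.

HB.instance Definition _ := PreTopologicalLmodule.on Cp.

End Cp.

Section strong_dual.
Context (R : realType) (E : preTopologicalLmodType R).

Definition tvs_bounded (B : set E) : Prop :=
  forall U : set E, nbhs 0 U ->
    \forall r \near +oo%R, B `<=` [set (r : R) *: u | u in U].

Definition continuous_linear_forms : {pred {family tvs_bounded, E -> R^o}} :=
  fun f => `[< linear (f : E -> R^o) /\ continuous (f : E -> R^o) >].

Lemma continuous_linear_forms_closed :
  GRing.submod_closed continuous_linear_forms.
Proof.
split; first by apply/asboolP; split=> [k x y|x];
  [rewrite /= scaler0 addr0|exact: cvg_cst].
move=> k f g /asboolP[lf cf] /asboolP[lg cg]; apply/asboolP; split=> [c x y|x].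
  rewrite /= -[LHS]/(k *: (f : E -> R^o) (c *: x + y) + (g : E -> R^o) (c *: x + y)).
  rewrite lf lg -[RHS]/(c *: (k *: (f : E -> R^o) x + (g : E -> R^o) x)
    + (k *: (f : E -> R^o) y + (g : E -> R^o) y)).
  by rewrite !scalerDr !scalerA (mulrC k) addrACA.
by apply: cvgD; [apply: cvgZl_tmp; exact: cf|exact: cg].
Qed.

HB.instance Definition _ :=
  GRing.isSubmodClosed.Build R {family tvs_bounded, E -> R^o}
    continuous_linear_forms continuous_linear_forms_closed.

Definition strong_dual := linear_subspace continuous_linear_forms.

HB.instance Definition _ := PreTopologicalLmodule.on strong_dual.

End strong_dual.

Section barrelled.
Context (R : realType) (E : preTopologicalLmodType R).

Definition absolutely_convex (A : set E) : Prop :=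
  forall (s t : R) (x y : E), `|s| + `|t| <= 1 -> A x -> A y ->
    A (s *: x + t *: y).

Definition absorbing (A : set E) : Prop :=
  forall x : E, exists2 r : R, 0 < r & [set r *: a | a in A] x.

Definition barrelled : Prop :=
  forall A : set E, closed A -> absolutely_convex A -> absorbing A ->
    nbhs 0 A.

End barrelled.

Definition distinguished (R : realType) (E : preTopologicalLmodType R) : Prop :=
  barrelled (strong_dual E).

Definition hereditarily_distinguished (R : realType)
    (E : preTopologicalLmodType R) : Prop :=
  forall M : submodClosed E, closed [set x : E | x \in M] ->
    distinguished (linear_subspace M).

(* Main.v *)
Require Import Defs.
From mathcomp Require Import all_boot all_order all_algebra.
From mathcomp Require Import all_classical all_reals all_analysis.
From mathcomp Require wochoice.
Import Order.TTheory GRing.Theory Num.Theory.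
Import numFieldNormedType.Exports.

(** The interval [[1, alpha]] is countable, so a subspace [M] of the function
    space carries the weak topology given by countably many continuous linear
    forms, the evaluations [e_0, e_1, ...] at its points; any such space is
    distinguished, because every absorbing absolutely convex set of its dual
    contains the polar of a bounded sequence.

    Let [tail n] be the common kernel of [e_0, ..., e_(n-1)].  Choose [v_n] in
    [tail n] with [e_n v_n = 1], or [v_n = 0] when [e_n] already vanishes on
    [tail n].  Subtracting multiples of [v_0, v_1, ...] in turn, as in Gauss
    elimination, yields continuous linear forms [g_i] such that, for every
    [f] and [n], the form [f - \sum_(i < n) f v_i *: g_i] is the composite of
    [f] with a linear map into [tail n].  A continuous form is controlled by finitely many
    [e_i], hence vanishes on some [tail n], so it is a finite sum
    [f = \sum_(i < n) f v_i *: g_i] ([dual_expansion]).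

    Let [A] be absolutely convex and absorbing in the dual, and write
    [g_i = r_i *: a_i] with [0 < r_i] and [a_i] in [A].  The sequence
    [2 ^+ i.+1 * r_i *: v_i] is bounded whatever the [r_i] are, since each
    [e_j] kills all its terms of index greater than [j]
    ([tail_vec_bounded]).  If [f] is at most [1] in absolute value on that
    sequence then [`|f v_i| * r_i <= 2^-1 ^+ i.+1], so the expansion of [f]
    exhibits it as an absolutely convex combination of the [a_i], and [f] lies
    in [A].  Thus [A] contains a strong neighbourhood of zero. *)

Set Implicit Arguments.
Unset Strict Implicit.
Unset Printing Implicit Defensive.

Local Open Scope classical_set_scope.
Local Open Scope ring_scope.

(** * The pairing of a space with its strong dual *)

Lemma subspace_val_continuous (R : realType) (E : preTopologicalLmodType R)
  (M : submodClosed E) : continuous (\val : linear_subspace M -> E).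
Proof. exact: (@initial_continuous {x : E | x \in M} E \val). Qed.

Lemma subspace_val_linear (R : realType) (E : preTopologicalLmodType R)
  (M : submodClosed E) : linear (\val : linear_subspace M -> E).
Proof. by []. Qed.

Section dual_pairing.
Context (R : realType) (E : preTopologicalLmodType R).
Implicit Types (f g : strong_dual E) (u v : E).

Definition pairing f u : R := (\val f : E -> R^o) u.

Lemma pairing_linear f : linear (pairing f : E -> R^o).
Proof. by have /asboolP[] := valP f. Qed.

Lemma pairing_continuous f : continuous (pairing f : E -> R^o).
Proof. by have /asboolP[] := valP f. Qed.

Lemma pairing0r f : pairing f 0 = 0.
Proof.
have := pairing_linear f 1 0 0.
by rewrite !scale1r addr0 => f0; apply: (addrI (pairing f 0)); rewrite addr0 -f0.
Qed.

Lemma pairingDZr f k u v : pairing f (u + k *: v) = pairing f u + k * pairing f v.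
Proof. by rewrite addrC pairing_linear addrC. Qed.

Lemma pairingZr f k u : pairing f (k *: u) = k * pairing f u.
Proof. by rewrite -[k *: u]add0r pairingDZr pairing0r add0r. Qed.

Lemma pairing0l u : pairing 0 u = 0.
Proof. by []. Qed.

Lemma pairingDZl f g k u : pairing (f + k *: g) u = pairing f u + k * pairing g u.
Proof. by []. Qed.

Lemma pairing_inj f g : (forall u, pairing f u = pairing g u) -> f = g.
Proof. by move=> fg; apply/val_inj/funext => u; exact: fg. Qed.

Lemma nbhs0_polar (B : set E) : tvs_bounded B ->
  nbhs (0 : strong_dual E) [set f | forall u, B u -> `|pairing f u| < 1].
Proof.
move=> bB.
pose V := [set xy : R^o * R^o | ball xy.1 1 xy.2].
have entV : entourage V by apply: (@entourage_ball _ _ (1%:pos)).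
have fV := fam_nbhs (\val (0 : strong_dual E)) entV bB.
have cV := @subspace_val_continuous R _ (@continuous_linear_forms R E) 0 _ fV.
apply: (@filterS (strong_dual E) (nbhs (0 : strong_dual E)) _ _ _ _ cV).
move=> f /= fB u /fB.
by rewrite /V/= -ball_normE/= sub0r normrN.
Qed.

End dual_pairing.

(** Absolute convexity speaks of two vectors at a time; geometric weights make
    the induction work, because the tail of the sum is one half of a sum of the
    same kind. *)
Lemma absolutely_convex_geometric_sum (R : realType)
    (E : preTopologicalLmodType R) (A : set E) (a : nat -> E) (s : nat -> R) n :
  absolutely_convex A -> (forall i, A (a i)) ->
  (forall i, `|s i| <= 2^-1 ^+ i.+1) -> A (\sum_(i < n) s i *: a i).
Proof.
move=> cA; elim: n a s => [|n IH] a s Aa sle.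
  rewrite big_ord0; have := cA 0 0 _ _ _ (Aa 0%N) (Aa 0%N).
  by rewrite !scale0r addr0; apply; rewrite normr0 addr0 ler01.
rewrite big_ord_recl /=.
have -> : \sum_(i < n) s (bump 0 i) *: a (bump 0 i) =
    2^-1 *: \sum_(i < n) (2 * s i.+1) *: a i.+1.
  rewrite scaler_sumr; apply: eq_bigr => i _.
  by rewrite scalerA mulKf ?pnatr_eq0.
apply: cA => //; last first.
  apply: (IH (fun i => a i.+1) (fun i => 2 * s i.+1)) => // i.
  by rewrite normrM gtr0_norm// -ler_pdivlMl// -exprS.
rewrite (le_trans (lerD (sle 0%N) (lexx _)))//.
by rewrite expr1 gtr0_norm ?invr_gt0// [leRHS]splitr div1r.
Qed.

(** * Spaces whose topology comes from countably many linear forms *)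

Section countably_many_forms.
Context (R : realType) (E : preTopologicalLmodType R) (e : nat -> strong_dual E).

Definition tail n : set E := [set u | forall i, (i < n)%N -> pairing (e i) u = 0].

(** The zero vector stands for the redundant indices [n], those for which [e n]
    vanishes on [tail n]; this spares the extraction of an independent
    subsequence of [e]. *)
Definition tail_vec n : E := xget 0 [set u | tail n u /\ pairing (e n) u = 1].

Lemma tail_vecP n : tail n (tail_vec n).
Proof. by rewrite /tail_vec; case: xgetP => [u _ []|_ i _]//; rewrite pairing0r. Qed.

Lemma pairing_tail_vec n u : tail n u ->
  pairing (e n) u * pairing (e n) (tail_vec n) = pairing (e n) u.
Proof.
move=> nu; rewrite /tail_vec; case: xgetP => [v _ [_ ->]|nex]; first by rewrite mulr1.
have [->|eu0] := eqVneq (pairing (e n) u) 0; first by rewrite mul0r.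
exfalso; apply: (nex ((pairing (e n) u)^-1 *: u)); split.
  by move=> i ilt; rewrite pairingZr (nu i) // mulr0.
by rewrite pairingZr mulVf.
Qed.

Fixpoint tail_proj n u : E :=
  if n is m.+1 then
    tail_proj m u + (- pairing (e m) (tail_proj m u)) *: tail_vec m
  else u.

(** The transpose of [tail_proj n], written inside the dual so that the
    continuity of the resulting forms is part of their type; the map
    [tail_proj n] itself may fail to be continuous, since [E] is only a linear
    space with a topology. *)
Fixpoint tail_trunc n (f : strong_dual E) : strong_dual E :=
  if n is m.+1 then
    tail_trunc m f + (- pairing f (tail_vec m)) *: tail_trunc m (e m)
  else f.

(** Step [n] kills [e n] by the normalisation of [tail_vec n], and does not
    disturb the earlier forms, which vanish on [tail_vec n]. *)
Lemma tail_projP n u : tail n (tail_proj n u).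
Proof.
elim: n => [|n IH] i //=; rewrite ltnS leq_eqVlt pairingDZr => /predU1P[->|ilt].
  by rewrite mulNr pairing_tail_vec// subrr.
by rewrite IH// (tail_vecP ilt) mulr0 addr0.
Qed.

Lemma pairing_tail_trunc n f u :
  pairing (tail_trunc n f) u = pairing f (tail_proj n u).
Proof.
elim: n f => //= n IH f.
by rewrite pairingDZl pairingDZr !IH !mulNr mulrC.
Qed.

Lemma tail_trunc_sum n f :
  tail_trunc n f + \sum_(i < n) pairing f (tail_vec i) *: tail_trunc i (e i) = f.
Proof.
elim: n => [|n IH] /=; first by rewrite big_ord0 addr0.
by rewrite big_ord_recr/= addrACA IH scaleNr addNr addr0.
Qed.

Hypothesis e_nbhs : forall U : set E, nbhs 0 U ->
  exists n, exists2 eps : R, 0 < eps &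
    forall u, (forall i, (i < n)%N -> `|pairing (e i) u| < eps) -> U u.

(** Some neighbourhood of zero on which [f] is bounded contains the whole linear
    space [tail n], and a linear form bounded on a linear space is zero there. *)
Lemma vanish_on_tail f : exists n, forall u, tail n u -> pairing f u = 0.
Proof.
have nf : nbhs (0 : E) [set u | `|pairing f u| < 1].
  have cf := @pairing_continuous _ _ f 0 _ (nbhsx_ballx (pairing f 0 : R^o) _ ltr01).
  apply: (@filterS E (nbhs (0 : E)) _ _ _ _ cf) => u.
  by rewrite /= -ball_normE/= pairing0r sub0r normrN.
have [n [eps eps0 nU]] := e_nbhs nf; exists n => u nu.
apply/eqP/negPn/negP => fu0.
have /nU/= : forall i, (i < n)%N -> `|pairing (e i) ((pairing f u)^-1 *: u)| < eps.
  by move=> i ilt; rewrite pairingZr (nu i) // mulr0 normr0.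
by rewrite pairingZr mulVf// normr1 ltxx.
Qed.

(** The forms [tail_trunc i (e i)] span the dual algebraically, with the values
    of [f] on the vectors [tail_vec i] as coefficients. *)
Lemma dual_expansion f : exists n,
  f = \sum_(i < n) pairing f (tail_vec i) *: tail_trunc i (e i).
Proof.
have [n nf] := vanish_on_tail f; exists n.
rewrite -[LHS](tail_trunc_sum n f).
suff -> : tail_trunc n f = 0 by rewrite add0r.
apply: pairing_inj => u; rewrite pairing_tail_trunc pairing0l.
exact/nf/tail_projP.
Qed.

(** Boundedness for arbitrary weights: a basic neighbourhood of zero involves
    only forms of index below some [n], which vanish on all terms but the first
    [n]. *)
Lemma tail_vec_bounded (b : nat -> R) :
  tvs_bounded (range (fun i => b i *: tail_vec i)).
Proof.
move=> U /e_nbhs[n [eps eps0 nU]].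
(* A crude common bound for the finitely many values that can be nonzero. *)
pose M : R := \sum_(i < n) \sum_(j < n) `|pairing (e j) (b i *: tail_vec i)|.
near=> r => _ [i _ <-].
have r0 : 0 < r by near: r; exact: nbhs_pinfty_gt.
exists (r^-1 *: (b i *: tail_vec i)); last by rewrite scalerA divff ?gt_eqF// scale1r.
apply: nU => j jn; rewrite pairingZr normrM gtr0_norm ?invr_gt0//.
have [ni|ilt] := leqP n i.
  by rewrite pairingZr (tail_vecP (leq_trans jn ni)) mulr0 normr0 mulr0.
rewrite ltr_pdivrMl// -ltr_pdivrMr//.
apply: (@le_lt_trans _ _ (M / eps)).
  rewrite ler_pM2r ?invr_gt0// /M (bigD1 (Ordinal ilt))//= (bigD1 (Ordinal jn))//=.
  by rewrite -addrA lerDl addr_ge0// ?sumr_ge0// => *; rewrite sumr_ge0.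
near: r; apply: nbhs_pinfty_gt; exact: num_real.
Unshelve. all: by end_near. Qed.

Lemma distinguished_of_countable_forms : distinguished E.
Proof.
move=> A _ cA absA.
have /choice[ra raP] i : exists ra : R * strong_dual E,
    [/\ 0 < ra.1, A ra.2 & ra.1 *: ra.2 = tail_trunc i (e i)].
  by have [r r0 [a Aa ra]] := absA (tail_trunc i (e i)); exists (r, a).
(* The factor [2 ^+ i.+1] makes the coefficients of a form of the polar decay
   geometrically, [(ra i).1] compensates the rescaling into [A]. *)
pose b i : R := 2 ^+ i.+1 * (ra i).1.
apply: filterS (nbhs0_polar (tail_vec_bounded b)) => f fB.
have [n ->] := dual_expansion f.
under eq_bigr => i _ do (have [_ _ <-] := raP i; rewrite scalerA).
apply: (absolutely_convex_geometric_sum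
  (a := fun i => (ra i).2) (s := fun i => pairing f (tail_vec i) * (ra i).1)) => // i.
  by have [] := raP i.
have [r0 _ _] := raP i.
have /ltW := fB _ (ex_intro2 _ _ i I erefl).
rewrite pairingZr !normrM normrX (gtr0_norm r0) (@gtr0_norm _ 2)// -mulrA.
by rewrite exprVn -ler_pdivlMl ?exprn_gt0// mulr1 mulrC.
Qed.

End countably_many_forms.

(** * Function spaces over a countable space *)

Section Cp_countable.
Context (R : realType) (X : topologicalType) (M : submodClosed (Cp R X)).

Definition point_value (u : linear_subspace M) : X -> R^o := \val (\val u).

Lemma evaluation_continuous x : continuous (fun u => point_value u x).
Proof.
move=> u.
have c1 := @subspace_val_continuous R (Cp R X) M u.
have c2 := @subspace_val_continuous R {ptws X -> R^o} (@continuous_funs R X)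
  (\val u).
have c3 : (fun f : {ptws X -> R^o} => f x) @
    nbhs (point_value u : {ptws X -> R^o}) --> point_value u x.
  exact: (proj1 (@pointwise_cvgP X R^o
    (nbhs (point_value u : {ptws X -> R^o})) (point_value u) _) (fun _ => id)).
exact: (cvg_comp _ _ (cvg_comp _ _ c1 c2) c3).
Qed.

Lemma evaluation_linear x :
  linear ((fun u => point_value u x) : linear_subspace M -> R^o).
Proof.
move=> k u v; rewrite /point_value (subspace_val_linear (M := M)).
by rewrite (subspace_val_linear (M := @continuous_funs R X)).
Qed.

Lemma evaluation_form_subproof x :
  ((fun u => point_value u x) : {family @tvs_bounded R (linear_subspace M),
                                   linear_subspace M -> R^o})
    \in @continuous_linear_forms R (linear_subspace M).
Proof.
apply/asboolP; split.
- exact: evaluation_linear.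
- exact: evaluation_continuous.
Qed.

Definition evaluation_form x : strong_dual (linear_subspace M) :=
  Sub (fun u => point_value u x) (evaluation_form_subproof x).

(** Convergence of arbitrary filters characterises the topology: applied to the
    filter generated by a family of sets, it shows that every neighbourhood of
    zero contains one of them. *)
Lemma cvg0_subspace (F : set_system (linear_subspace M)) : Filter F ->
  (forall x, (fun u => point_value u x) @ F --> (0 : R^o)) ->
  F --> (0 : linear_subspace M).
Proof.
move=> FF cvF.
have : {ptws, point_value @ F --> (fun=> 0 : R^o)} by apply/pointwise_cvgP.
move=> cv U [_ [[_ [V oV <-] <-]]] /= V0 VU.
apply: filterS VU _; apply: cv.
exact: (@open_nbhs_nbhs {ptws X -> R^o}).
Qed.

Lemma countable_subspace_distinguished :
  countable [set: X] -> distinguished (linear_subspace M).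
Proof.
move=> /countable_injP[k /in2TT kinj].
(* The zero form fills the indices that code no point. *)
pose e n : strong_dual (linear_subspace M) :=
  if pselect (exists x, k x = n) is left h then evaluation_form (projT1 (cid h))
  else 0.
have eE x u : pairing (e (k x)) u = point_value u x.
  rewrite /e; case: pselect => [h|[]]; last by exists x.
  by case: cid => y /= /kinj ->.
apply: (@distinguished_of_countable_forms _ _ e) => U U0.
(* The filter generated by the [e i]-neighbourhoods of zero converges pointwise
   to zero, hence is finer than the neighbourhood filter of zero. *)
pose F : set_system (linear_subspace M) :=
  [set V | exists n, exists2 eps : R, 0 < eps & forall u,
    (forall i, (i < n)%N -> `|pairing (e i) u| < eps) -> V u].
have FF : Filter F.
  split; first by exists 0%N, 1.
    move=> V W [n [eps eps0 nV]] [m [del del0 mW]].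
    exists (maxn n m), (Num.min eps del); first by rewrite lt_min eps0.
    move=> u uP; split.
      apply: nV => i ilt.
      by have := uP i; rewrite lt_min leq_max ilt => /(_ isT)/andP[].
    apply: mW => i ilt.
    by have := uP i; rewrite lt_min leq_max ilt orbT => /(_ isT)/andP[].
  by move=> V W VW [n [eps eps0 nV]]; exists n, eps => // u /nV; exact: VW.
suff : F --> (0 : linear_subspace M) by move=> /(_ _ U0).
apply: cvg0_subspace.
move=> x; apply/cvgrPdist_lt => eps eps0.
exists (k x).+1, eps => // u /(_ (k x) (ltnSn _)).
by rewrite eE /= sub0r normrN.
Qed.

End Cp_countable.

(** The code [0] is kept for the endpoint [a], which [countable_ordinal] does not
    count. *)
Lemma countable_ord_itv1 d (O : bOrderType d) (a : O) :
  countable_ordinal a -> countable [set: ord_itv1 a].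
Proof.
move=> /countable_injP[k kinj].
apply/countable_injP.
exists (fun x => if \val x == a then 0%N else (k (\val x)).+1).
move=> x y _ _.
have lta (z : ord_itv1 a) : \val z != a -> (\val z : O) \in [set b : O | (b < a)%O].
  move=> za; apply/mem_set => /=; rewrite lt_neqAle za /=.
  by have /andP[] := valP z.
case: eqVneq => [xa|xa]; case: eqVneq => [ya|ya] //.
  by move=> _; apply: val_inj; rewrite xa ya.
by move=> [] /kinj xy; apply/val_inj/xy; exact: lta.
Qed.

Theorem theorem3p4 (R : realType) (d : Order.disp_t) (O : bOrderType d)
    (wo : wochoice.well_order (<=%O : rel O)) (alpha : O) :
  countable_ordinal alpha ->
  hereditarily_distinguished (Cp R (order_topology (ord_itv1 alpha))).
Proof.
move=> /countable_ord_itv1 calpha M _.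
exact: countable_subspace_distinguished.
Qed.
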